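(* Let $\lambda\in\mathbb{R}^p$, $\Lambda\in\mathbb{R}^{p\times p}$, and suppose there is a factorization $$\begin{pmatrix}\Lambda&\lambda\\ \lambda^\top&1\end{pmatrix}=\sum_{k=1}^K\begin{pmatrix}\lambda^{(k)}\\ \xi^{(k)}\end{pmatrix}\begin{pmatrix}\lambda^{(k)}\\ \xi^{(k)}\end{pmatrix}^\top$$ with $\lambda^{(k)}\in\mathbb{R}^p$ and $\xi^{(k)}\in\mathbb{R}$. Let $V\in\mathbb{R}^{L\times p}$, $v\in\mathbb{R}^L$ and $i\in\{1,\dots,L\}$. Then $V_{i,*}\lambda^{(k)}=\xi^{(k)}v_i$ for all $k=1,\dots,K$ if and only if $$V_{i,*}\lambda=v_i\qquad\text{and}\qquad\langle V_{i,*}^\top V_{i,*},\Lambda\rangle=v_i^2.$$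
   Context: $V_{i,*}$ denotes the $i$-th row of $V$ (a row vector), and $\langle X,Y\rangle=\mathrm{Tr}(X^\top Y)$ is the matrix inner product. *)

(* Defs.v *)
From mathcomp Require Import all_boot all_order all_algebra.

Set Implicit Arguments.
Unset Strict Implicit.
Unset Printing Implicit Defensive.

Import GRing.Theory.
Local Open Scope ring_scope.

Definition mxinner (R : pzRingType) (m n : nat) (X Y : 'M[R]_(m, n)) : R :=
  \tr (X^T *m Y).

(* Main.v *)
Require Import Defs.
From mathcomp Require Import all_boot all_order all_algebra.
From mathcomp Require Import reals.
From mathcomp Require Import ring.

(** Fix the row [w = row i V], the scalar [c = v i 0], and write
    [a k = w *m lambdak k].  Reading the factorization block by block and
    contracting with [w] turns the three blocks into three scalar sums:
    [w *m lambda = \sum_k xi k * a k], [w *m Lambda *m w^T = \sum_k a k ^+ 2]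
    and [1 = \sum_k xi k ^+ 2].  Together they give the variance-like identity
    [\sum_k (a k - xi k * c) ^+ 2
       = w *m Lambda *m w^T - 2 c (w *m lambda) + c ^+ 2],
    whose right-hand side vanishes under the two aggregate equations; over the
    reals a vanishing sum of squares has vanishing terms.  This is also the
    equality case of Cauchy-Schwarz for [a] and the unit vector [xi].  The
    converse substitutes [a k = xi k * c] in the sums.

    [gram_blocks] extracts the blocks, [mxinner_outer] and [quad_form_gram] turn
    the trace pairing into [\sum_k a k ^+ 2], and [sum_sqr_eq_scale] is the
    remaining equivalence between scalars. *)

Set Implicit Arguments.
Unset Strict Implicit.
Unset Printing Implicit Defensive.

Import GRing.Theory.
Local Open Scope ring_scope.

Lemma gram_blocks (R : comNzRingType) (p K : nat)
    (A : 'M[R]_p) (b : 'cV[R]_p) (t : R) (x : 'I_K -> 'cV[R]_p) (xi : 'I_K -> R) :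
  block_mx A b b^T t%:M =
    \sum_(k < K) col_mx (x k) (xi k)%:M *m (col_mx (x k) (xi k)%:M)^T ->
  [/\ A = \sum_k x k *m (x k)^T, b = \sum_k xi k *: x k
    & t = \sum_k xi k ^+ 2].
Proof.
under eq_bigr do
  rewrite tr_col_mx mul_col_row tr_scalar_mx mul_mx_scalar mul_scalar_mx
          -scalar_mxM -expr2.
move=> E; split.
- rewrite -[LHS](block_mxKul A b b^T t%:M) E /ulsubmx !raddf_sum /=.
  by apply: eq_bigr => k _; exact: block_mxKul.
- rewrite -[LHS](block_mxKur A b b^T t%:M) E /ursubmx !raddf_sum /=.
  by apply: eq_bigr => k _; exact: block_mxKur.
- have : t%:M = \sum_k (xi k ^+ 2)%:M :> 'M[R]_1.
    rewrite -[LHS](block_mxKdr A b b^T t%:M) E /drsubmx !raddf_sum /=.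
    by apply: eq_bigr => k _; exact: block_mxKdr.
  move/matrixP/(_ 0 0); rewrite summxE mxE eqxx mulr1n => ->.
  by apply: eq_bigr => k _; rewrite mxE eqxx mulr1n.
Qed.

(** Cyclicity of the trace: pairing with the outer product of a row with itself
    evaluates the associated quadratic form. *)
Lemma mxinner_outer (R : comNzRingType) (p : nat) (w : 'rV[R]_p) (A : 'M[R]_p) :
  mxinner (w^T *m w) A = (w *m A *m w^T) 0 0.
Proof.
by rewrite /mxinner trmx_mul trmxK -[in LHS]mulmxA mxtrace_mulC [LHS]trace_mx11.
Qed.

Lemma quad_form_gram (R : comNzRingType) (p K : nat) (w : 'rV[R]_p)
    (x : 'I_K -> 'cV[R]_p) :
  (w *m (\sum_k x k *m (x k)^T) *m w^T) 0 0 = \sum_k ((w *m x k) 0 0) ^+ 2.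
Proof.
rewrite mulmx_sumr mulmx_suml summxE; apply: eq_bigr => k _.
by rewrite mulmxA -mulmxA -trmx_mul mxE big_ord1 [X in _ * X]mxE expr2.
Qed.

(** The equality case of Cauchy-Schwarz against a unit vector: both sides say
    that [\sum_k (a k - xi k * c) ^+ 2] is zero. *)
Lemma sum_sqr_eq_scale (R : realDomainType) (I : finType) (a xi : I -> R) (c : R) :
  \sum_k xi k ^+ 2 = 1 ->
  (forall k, a k = xi k * c) <->
  \sum_k xi k * a k = c /\ \sum_k a k ^+ 2 = c ^+ 2.
Proof.
move=> xi1; split=> [aE | [xia aa]].
  split.
    under eq_bigr do rewrite aE mulrA -expr2.
    by rewrite -mulr_suml xi1 mul1r.
  under eq_bigr do rewrite aE exprMn.
  by rewrite -mulr_suml xi1 mul1r.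
have sqr0 : \sum_k (a k - xi k * c) ^+ 2 = 0.
  transitivity (\sum_k a k ^+ 2 - (\sum_k xi k * a k) * (2 * c)
                + (\sum_k xi k ^+ 2) * c ^+ 2); last by rewrite aa xia xi1; ring.
  rewrite !mulr_suml -sumrB -big_split /=.
  by apply: eq_bigr => k _; ring.
move=> k; apply/eqP; rewrite -subr_eq0 -sqrf_eq0.
by rewrite (Num.Theory.psumr_eq0P _ sqr0) // => j _; exact: Num.Theory.sqr_ge0.
Qed.

Theorem theorem4p2 (R : realType) (p K L : nat)
    (lambda : 'cV[R]_p) (Lambda : 'M[R]_p)
    (lambdak : 'I_K -> 'cV[R]_p) (xi : 'I_K -> R)
    (Hfact : block_mx Lambda lambda lambda^T 1%:M =
       \sum_(k < K) col_mx (lambdak k) (xi k)%:M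
                    *m (col_mx (lambdak k) (xi k)%:M)^T)
    (V : 'M[R]_(L, p)) (v : 'cV[R]_L) (i : 'I_L) :
  (forall k : 'I_K, (row i V *m lambdak k) 0 0 = xi k * v i 0) <->
  ((row i V *m lambda) 0 0 = v i 0 /\
   mxinner ((row i V)^T *m row i V) Lambda = v i 0 ^+ 2).
Proof.
have [LambdaE lambdaE xi1] := gram_blocks Hfact.
rewrite mxinner_outer LambdaE quad_form_gram.
have -> : (row i V *m lambda) 0 0 = \sum_k xi k * (row i V *m lambdak k) 0 0.
  rewrite lambdaE mulmx_sumr summxE.
  by apply: eq_bigr => k _; rewrite -scalemxAr mxE.
exact: (sum_sqr_eq_scale (fun k => (row i V *m lambdak k) 0 0) _ (esym xi1)).
Qed.
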